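(* Let $\nu\in\mathcal P_s$ with $\nu(\{0\})=0$, and let $t\ge a>0$ with $\nu(\{a\})=\nu(\{t\})=0$ and $G(t)\ne2G(a)$. Write $D=2G(a)-G(t)$. Then $II(1,a,t)=\frac12\big(H(a)+H(t)+G(a)+G(t)\big)$ and for all $n\ge2$ $$\begin{aligned}II(n,a,t)={}&G(a)^n\Big[\frac{(n+1)H(a)+G(a)}{D}-\frac{2G(a)H(a)}{D^2}+\frac{H(t)}{D}\Big(nC_2+C_3-\frac{2C_2G(a)}{D}\Big)\Big]\\&+\Big(\frac{G(t)}2\Big)^{n-1}\Big[II(1,a,t)-\frac{G(a)(H(a)+G(a))}{D}+\frac{G(a)G(t)H(a)}{D^2}+\frac{(n-1)C_1H(t)}{G(t)}-\frac{G(a)H(t)}{D}\Big(C_3-\frac{C_2G(t)}{D}\Big)\Big],\end{aligned}$$ where $I(1,a,t)=\tfrac12G(t)+\tfrac12H(a)\Psi(\tfrac at)+\tfrac12G(a)$ and $C_1=I(1,a,t)-\frac{G(a)}{D}\big[G(a)+H(a)\Psi(\frac at)(1-\frac{G(t)}{D})\big]$, $C_2=\frac{H(a)\Psi(\frac at)}{D}$, $C_3=\frac{H(a)\Psi(\frac at)+G(a)}{D}-\frac{2H(a)G(a)\Psi(\frac at)}{D^2}$.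
   Context: Fix $\alpha>0$. $\mathcal P_s$ is the set of symmetric Borel probability measures on $\mathbb R$. For $x\in\mathbb R$, $\widetilde\delta_x=\frac12(\delta_x+\delta_{-x})$. For a probability measure $\lambda=\mathcal L(X)$ and $c>0$, $T_c\lambda=\mathcal L(cX)$, and $T_0\lambda=\delta_0$. $\widetilde\pi_{2\alpha}$ is the symmetric Pareto probability measure with density $\alpha|y|^{-2\alpha-1}\mathbf 1_{\{|y|\ge1\}}$. The Kendall convolution $\vartriangle_\alpha$ on $\mathcal P_s$ is defined by $\widetilde\delta_x\vartriangle_\alpha\widetilde\delta_y=T_M\big(\varrho^\alpha\widetilde\pi_{2\alpha}+(1-\varrho^\alpha)\widetilde\delta_1\big)$ where $M=\max(|x|,|y|)$, $m=\min(|x|,|y|)$, $\varrho=m/M$ (and $\varrho=0$ if $M=0$), extended by $(\nu_1\vartriangle_\alpha\nu_2)(A)=\int\int(\widetilde\delta_x\vartriangle_\alpha\widetilde\delta_y)(A)\,\nu_1(dx)\nu_2(dy)$. For $x\in\mathbb R$ and $\mu\in\mathcal P_s$ we write $\delta_x\vartriangle_\alpha\mu:=\widetilde\delta_x\vartriangle_\alpha\mu$. $\Psi(t)=(1-|t|^\alpha)_+$. For the measure $\nu$: $F(t)=\nu((-\infty,t])$, $G(t)=\int_{\mathbb R}\Psi(x/t)\,\nu(dx)$ for $t\neq0$, and for $t>0$, $H(t)=2F(t)-1-G(t)=t^{-\alpha}\int_{[-t,t]}|x|^\alpha\nu(dx)$. The Kendall random walk with step distribution $\nu$ is the Markov chain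 $(X_n)_{n\ge0}$ with $X_0=0$ and transition kernel $\mathbb P(X_{k+1}\in A\mid X_k=x)=(\delta_x\vartriangle_\alpha\nu)(A)$. For $a,t>0$ and $n\ge1$, $II(n,a,t)=\int_{(-\infty,a]}\cdots\int_{(-\infty,a]}\mathbf 1_{\{|x_n|<t\}}\,(\delta_{x_{n-1}}\vartriangle_\alpha\nu)(dx_n)\cdots(\delta_{x_1}\vartriangle_\alpha\nu)(dx_2)\,\nu(dx_1)$ ($n$ integrations), i.e. $II(n,a,t)=\mathbb P(X_1\le a,\dots,X_n\le a,\ |X_n|<t)$. *)

(* Defs.v *)
From HB Require Import structures.
From mathcomp Require Import all_boot all_order all_algebra.
From mathcomp Require Import all_classical all_reals all_analysis.
Import Order.TTheory GRing.Theory Num.Theory numFieldNormedType.Exports.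

Set Implicit Arguments.
Unset Strict Implicit.
Unset Printing Implicit Defensive.

Local Open Scope classical_set_scope.
Local Open Scope ring_scope.

Section Kendall.
Variable R : realType.

Definition Psi (alpha t : R) : R := Num.max (1 - `|t| `^ alpha) 0.

Definition symmetric_prob (nu : probability R R) : Prop :=
  forall A : set R, measurable A -> nu ((-%R) @^-1` A) = nu A.

Definition cdfF (nu : probability R R) (t : R) : R :=
  fine (nu [set` `]-oo, t]]).

Definition Gf (alpha : R) (nu : probability R R) (t : R) : R :=
  fine (\int[nu]_x (Psi alpha (x / t))%:E).

Definition Hf (alpha : R) (nu : probability R R) (t : R) : R :=
  2 * cdfF nu t - 1 - Gf alpha nu t.

(* \int f d(T_M pi~_{2alpha}) = \int f(M u) alpha |u|^{-2alpha-1} 1_{|u|>=1} du *)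
Definition pareto_int (alpha M : R) (f : R -> \bar R) : \bar R :=
  (\int[@lebesgue_measure R]_(u in [set u : R | (1 <= `|u|)%R])
     (f (M * u)%R * (alpha * `|u| `^ (- (2 * alpha) - 1))%R%:E))%E.

(* \int f d(delta~_x Kendall delta~_y):
   T_M(rho^alpha pi~_{2alpha} + (1-rho^alpha) delta~_1), with T_0 = delta_0 *)
Definition kendall_pair_int (alpha : R) (f : R -> \bar R) (x y : R) : \bar R :=
  let M : R := Num.max `|x| `|y| in
  let m : R := Num.min `|x| `|y| in
  if M == 0 then f 0 else
  let rho : R := m / M in
  ((rho `^ alpha)%:E * pareto_int alpha M f
   + ((1 - rho `^ alpha) / 2)%:E * (f M + f (- M)%R))%E.

(* \int f(y) (delta_x Kendall nu)(dy) = \int\int f d(delta~_x Kendall delta~_z) nu(dz) *)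
Definition kernel_int (alpha : R) (nu : probability R R) (f : R -> \bar R)
  (x : R) : \bar R :=
  \int[nu]_z kendall_pair_int alpha f x z.

(* backward iteration of the nested integrals:
   hseq 0 y = 1_{|y|<t},
   hseq (k+1) x = \int 1_{y<=a} hseq k y (delta_x Kendall nu)(dy) *)
Fixpoint hseq (alpha : R) (nu : probability R R) (a t : R) (k : nat)
  : R -> \bar R :=
  match k with
  | 0%N => fun y => (if (`|y| < t)%R then 1 else 0)%R%:E
  | k'.+1 => fun x =>
      kernel_int alpha nu
        (fun y => if (y <= a)%R then hseq alpha nu a t k' y else 0%E) x
  end.

(* II(n,a,t) for n >= 1 *)
Definition II (alpha : R) (nu : probability R R) (n : nat) (a t : R) : R :=
  fine (\int[nu]_x (if (x <= a)%R then hseq alpha nu a t n.-1 x else 0%E)).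

End Kendall.

(* Main.v *)
Require Import Defs.
From HB Require Import structures.
From mathcomp Require Import all_boot all_order all_algebra.
From mathcomp Require Import all_classical all_reals all_analysis.
From mathcomp Require Import measurable_realfun ring lra.
Import Order.TTheory GRing.Theory Num.Theory numFieldNormedType.Exports.
Local Open Scope classical_set_scope.
Local Open Scope ring_scope.

(** Write [e_s] for the indicator of the ball of radius [s], [psi_s y] for
    [Psi (y / s)], and [K] for integration against the Kendall kernel. The
    pair kernel [<phi>(x, z)] ([sym_pair]) satisfies [<psi_s>(x, z) = psi_s x * psi_s z] and
    [<e_s>(x, z) = psi_s x * e_s z + (e_s x - psi_s x) * psi_s z], whence
    [K psi_s = G s * psi_s] and [K e_s = G s * e_s + H s * psi_s]. An even
    function [h] satisfies [K (1_{y <= a} h) = K (h + e_a h) / 2], and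
    multiplication by [e_a] maps [e_t] to [e_a] and [psi_t] to
    [Psi (a / t) * e_a + (1 - Psi (a / t)) * psi_a]. The span of
    [e_t, psi_t, e_a, psi_a] is therefore invariant, and the nested integrals
    reduce to a triangular linear recurrence on four coefficients. *)

(** * Integrals of powers over rays and bounded intervals starting at 1 *)

Section PowerIntegrals.
Context {R : realType}.
Local Notation leb := (@lebesgue_measure R).

Lemma powRN_cvgy0 (c : R) : 0 < c -> x `^ (- c) @[x --> +oo] --> (0 : R).
Proof.
move=> c0; apply/cvgr0Pnorm_lt => e e0.
near=> x.
have x0 : 0 < x by near: x; exact: nbhs_pinfty_gt.
rewrite ger0_norm ?powR_ge0//.
(* The threshold is the solution of x^(-c) = e; raising the bound to the power [c] gives x^c >
   1/e. *)
have : e `^ (- c^-1) < x by near: x; apply: nbhs_pinfty_gt; rewrite num_real.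
move=> /(gt0_ltr_powR c0); rewrite !nnegrE powR_ge0 => /(_ isT (ltW x0)).
rewrite -powRrM mulNr mulVf ?gt_eqF// => H.
rewrite powRN powRr1 ?(ltW e0)// in H.
by rewrite powRN invf_plt ?posrE ?powR_gt0.
Unshelve. all: by end_near. Qed.

Lemma powR_derivative (c x : R) : 0 < x -> c != 0 ->
  is_derive x 1 (fun u : R => - (u `^ (- c)) : R) (c * x `^ (- c - 1)).
Proof.
move=> x0 c0; have h := @is_derive1_powR R (- c) x x0.
by apply: is_derive_eq; rewrite mulNr opprK.
Qed.

Lemma powR_continuous_gt0 (c x : R) : 0 < x ->
  (fun u : R => u `^ c) @ x --> x `^ c.
Proof.
move=> x0; have [h _] := @is_derive1_powR R c x x0.
by move/derivable1_diffP/differentiable_continuous : h.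
Qed.

Lemma continuous_powR_within (A : set R) (c : R) : (forall x, A x -> 0 < x) ->
  {within A, continuous (fun u : R => u `^ c)}.
Proof.
move=> A0; apply: continuous_in_subspaceT => x /set_mem /A0 x0.
exact: powR_continuous_gt0.
Qed.

(** The antiderivative is -u^(-c). The right end is left open because the cut-off functions
    integrated later are known only strictly inside their ball. *)
Lemma integral_powR_itv (c S : R) : 0 < c -> 1 <= S ->
  \int[leb]_(u in `[1, S[) (c * u `^ (- c - 1)) = 1 - S `^ (- c).
Proof.
move=> c0; rewrite le_eqVlt => /predU1P[<-|S1].
  by rewrite set_itvco0 ?Rintegral_set0 ?powR1 ?subrr//.
have cont : {within `[1, S], continuous (fun u : R => c * u `^ (- c - 1))}.
  move=> x; apply: cvgM; first exact: cvg_cst.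
  apply: continuous_powR_within => y /=; rewrite in_itv/= => /andP[y1 _].
  exact: lt_le_trans y1.
have intS : leb.-integrable `[1, S] (EFin \o (fun u : R => c * u `^ (- c - 1))).
  by apply: continuous_compact_integrable => //; exact: segment_compact.
rewrite Rintegral_itv_bndo_bndc; last first.
  by apply: integrableS intS => //; apply: subset_itvl; rewrite bnd_simp.
rewrite /Rintegral (@continuous_FTC2 _ _ (fun u : R => - (u `^ (- c)) : R))//=.
- by rewrite powR1 opprK addrC.
- split.
  + move=> x; rewrite in_itv/= => /andP[x1 _].
    by have [] := powR_derivative c x (lt_trans ltr01 x1) (lt0r_neq0 c0).
  + apply: cvg_at_right_filter; apply: cvgN; exact: (powR_continuous_gt0 _ _ ltr01).
  + apply: cvg_at_left_filter; apply: cvgN.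
    exact: (powR_continuous_gt0 _ _ (lt_trans ltr01 S1)).
- move=> x; rewrite in_itv/= => /andP[x1 _]; rewrite derive1E.
  by have [_ ->] := powR_derivative c x (lt_trans ltr01 x1) (lt0r_neq0 c0).
Qed.

(** The integrand is nonnegative, so it suffices that its improper integral is finite; the
    antiderivative -u^(-c) tends to 0 at infinity. *)
Lemma integrable_powR_itvy (c : R) : 0 < c ->
  leb.-integrable `[1, +oo[ (EFin \o (fun u : R => c * u `^ (- c - 1))).
Proof.
move=> c0; apply/integrableP; split.
  apply/measurable_EFinP; apply: measurable_funM => //.
  exact: measurable_funTS.
under eq_integral.
  move=> u; rewrite inE/= in_itv/= andbT => u1.
  rewrite ger0_norm; last by rewrite mulr_ge0 ?powR_ge0// ltW.
  over.
rewrite (@ge0_continuous_FTC2y _ _ (fun u : R => - (u `^ (- c)) : R) _ 0)//.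
- by rewrite -EFinB ltry.
- by move=> x x1; rewrite mulr_ge0 ?powR_ge0// ltW.
- move=> x; apply: cvgM; first exact: cvg_cst.
  apply: continuous_powR_within => y /=; rewrite in_itv/= andbT.
  exact: lt_le_trans.
- rewrite -oppr0; apply: cvgN; exact: powRN_cvgy0.
- move=> x x1.
  by have [] := powR_derivative c x (lt_trans ltr01 x1) (lt0r_neq0 c0).
- apply: cvg_at_right_filter; apply: cvgN; exact: (powR_continuous_gt0 _ _ ltr01).
- move=> x; rewrite in_itv/= andbT => x1; rewrite derive1E.
  by have [_ ->] := powR_derivative c x (lt_trans ltr01 x1) (lt0r_neq0 c0).
Qed.

Lemma integrable_powR_itvco (c S : R) : 0 < c ->
  leb.-integrable `[1, S[ (EFin \o (fun u : R => c * u `^ (- c - 1))).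
Proof.
move=> c0; apply: integrableS (integrable_powR_itvy _ c0) => //.
by apply: subset_itvl; rewrite bnd_simp.
Qed.

End PowerIntegrals.

(** * Bounded measurable functions as the working class of integrands *)

Section BoundedMeasurable.
Context {R : realType}.

Definition bounded_measurable (f : R -> R) : Prop :=
  measurable_fun setT f /\ exists B : R, forall x, `|f x| <= B.

Lemma bounded_measurableD {f g : R -> R} :
  bounded_measurable f -> bounded_measurable g ->
  bounded_measurable (fun x => f x + g x).
Proof.
move=> [mf [B fB]] [mg [C gC]]; split; first exact: measurable_funD.
by exists (B + C) => x; rewrite (le_trans (ler_normD _ _))// lerD.
Qed.

Lemma bounded_measurableM {f g : R -> R} :
  bounded_measurable f -> bounded_measurable g ->
  bounded_measurable (fun x => f x * g x).
Proof.
move=> [mf [B fB]] [mg [C gC]]; split; first exact: measurable_funM.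
by exists (B * C) => x; rewrite normrM ler_pM.
Qed.

Lemma bounded_measurable_cst (k : R) : bounded_measurable (fun=> k).
Proof. by split => //; exists `|k|. Qed.

Lemma bounded_measurableZ (k : R) {f : R -> R} :
  bounded_measurable f -> bounded_measurable (fun x => k * f x).
Proof. exact: bounded_measurableM (bounded_measurable_cst k). Qed.

Lemma bounded_measurable_comp {f g : R -> R} :
  bounded_measurable f -> measurable_fun setT g ->
  bounded_measurable (f \o g).
Proof.
move=> [mf [B fB]] mg; split; first exact: measurableT_comp.
by exists B => x /=.
Qed.

Lemma bounded_measurable_bounded {f : R -> R} (A : set R) :
  bounded_measurable f -> [bounded f x | x in A].
Proof.
move=> [_ [B fB]]; exists B; split; first exact: num_real.
by move=> C BC x _ /=; rewrite (le_trans (fB x)) ?ltW.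
Qed.

Lemma bounded_measurable_integrable (nu : probability R R) {f : R -> R} :
  bounded_measurable f -> nu.-integrable setT (EFin \o f).
Proof.
move=> bf; apply: measurable_bounded_integrable => //.
- by rewrite (le_lt_trans (probability_le1 _ _)) ?ltry.
- by case: bf.
- exact: bounded_measurable_bounded.
Qed.

End BoundedMeasurable.

(** * Integration against the symmetric Pareto law *)

Section Pareto.
Context {R : realType}.
Variable alpha : R.
Hypothesis alpha_gt0 : 0 < alpha.
Local Notation leb := (@lebesgue_measure R).

Definition pareto_weight (u : R) : R := alpha * u `^ (- (2 * alpha) - 1).

(** Share of the ray [u >= 1] in the integral against the Pareto law scaled by [M]. This ray carries
    mass 1/2, whence the factors 2 in front of [half_pareto] below. *)
Definition half_pareto (phi : R -> R) (M : R) : R :=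
  \int[leb]_(u in `[1, +oo[) (phi (M * u) * pareto_weight u).

Lemma integrable_half_pareto {phi : R -> R} (M : R) : bounded_measurable phi ->
  leb.-integrable `[1, +oo[
    (EFin \o (fun u => phi (M * u) * pareto_weight u)).
Proof.
move=> bphi.
(* The factor 1/2 compensates for the coefficient [2 * alpha] of the power function known to be
   integrable. *)
have bphiM : bounded_measurable (fun u : R => 2^-1 * phi (M * u)).
  apply: bounded_measurableZ; apply: (bounded_measurable_comp bphi).
  exact: measurable_funM.
have a2 : 0 < 2 * alpha by rewrite mulr_gt0.
have := integrable_powR_itvy _ a2 => /(integrableMr _).
move=> /(_ _ (fun u : R => 2^-1 * phi (M * u))) H.
have {}H := H _ _ (bounded_measurable_bounded _ bphiM).
apply: eq_integrable (H _ _) => //.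
- by move=> u _ /=; rewrite -EFinM /pareto_weight; congr EFin; field.
- apply: measurable_funTS; by case: bphiM.
Qed.

Lemma EFin_half_pareto {phi : R -> R} (M : R) : bounded_measurable phi ->
  (half_pareto phi M)%:E =
  (\int[leb]_(u in `[1%R, +oo[) (phi (M * u) * pareto_weight u)%:E)%E.
Proof.
move=> bphi; rewrite fineK//.
by apply: (integrable_fin_num _ (integrable_half_pareto M bphi)).
Qed.

Lemma half_pareto_linear (c d : R) {phi psi : R -> R} (M : R) :
  bounded_measurable phi -> bounded_measurable psi ->
  half_pareto (fun y => c * phi y + d * psi y) M =
  c * half_pareto phi M + d * half_pareto psi M.
Proof.
move=> bphi bpsi; rewrite /half_pareto.
rewrite -!RintegralZl//; try exact: integrable_half_pareto.
rewrite -RintegralD//.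
- by apply: eq_Rintegral => u _; ring.
- have := integrable_half_pareto M (bounded_measurableZ c bphi).
  by apply: eq_integrable => // u _ /=; rewrite mulrA.
- have := integrable_half_pareto M (bounded_measurableZ d bpsi).
  by apply: eq_integrable => // u _ /=; rewrite mulrA.
Qed.

(** The domain |u| >= 1 is the union of two disjoint rays, and the reflection of Lebesgue measure
    carries the negative ray to the positive one. *)
Lemma pareto_int_half {g : R -> R} (M : R) : bounded_measurable g ->
  pareto_int alpha M (EFin \o g) =
  (half_pareto g M + half_pareto (fun y => g (- y)) M)%:E.
Proof.
move=> bg.
pose k (u : R) : R := g (M * u) * (alpha * `|u| `^ (- (2 * alpha) - 1)).
have mk : measurable_fun setT k.
  apply: measurable_funM.
    apply: measurableT_comp; [by case: bg|exact: measurable_funM].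
  apply: measurable_funM => //.
  apply: (measurableT_comp (measurable_powR _)); exact: normr_measurable.
have bgN : bounded_measurable (fun y => g (- y)).
  by apply: (bounded_measurable_comp bg); exact: oppr_measurable.
have kE u : `[1, +oo[%classic u -> k u = g (M * u) * pareto_weight u.
  by rewrite /= in_itv/= andbT => u1; rewrite /k ger0_norm// (le_trans ler01).
have kNE u : `[1, +oo[%classic u -> k (- u) = g (- (M * u)) * pareto_weight u.
  rewrite /= in_itv/= andbT => u1.
  by rewrite /k normrN ger0_norm ?(le_trans ler01)// mulrN.
have ->: pareto_int alpha M (EFin \o g) =
    (\int[leb]_(u in `[1%R, +oo[ `|` `]-oo, (-1)%R]) (k u)%:E)%E.
  rewrite /pareto_int; congr (integral _ _ _).
  apply/seteqP; split => u /=; rewrite !in_itv/= andbT ler_normr lerNr.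
    by move=> /orP[]; [left|right].
  by move=> [->//|->]; rewrite orbT.
rewrite integral_setU_EFin//; last 2 first.
- exact: measurable_funTS.
- apply/disj_setPS => u /= [] /[!in_itv]/= /andP[u1 _] uN1.
  by have := le_trans u1 uN1; rewrite lerNr; lra.
have right_half : (\int[leb]_(u in `[1%R, +oo[) (k u)%:E)%E =
    (half_pareto g M)%:E.
  rewrite (EFin_half_pareto M bg).
  by apply: eq_integral => u /set_mem /kE ->.
have left_half : (\int[leb]_(u in `]-oo, (-1)%R]) (k u)%:E)%E =
    (half_pareto (fun y => g (- y)) M)%:E.
  rewrite (EFin_half_pareto M bgN).
  pose opp : measurableTypeR R -> measurableTypeR R := -%R.
  have mopp : measurable_fun setT opp by exact: oppr_measurable.
  transitivity (\int[pushforward leb opp]_(u in `]-oo, (-1)%R]) (k u)%:E)%E.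
    by apply: eq_measure_integral => A mA _; exact/esym/lebesgue_measureN.
  have oppE : opp @^-1` `]-oo, (-1)%R] = `[1%R, +oo[%classic.
    by apply/seteqP; split => u /=; rewrite !in_itv/= andbT lerN2.
  rewrite (integral_pushforward mopp)//; last 2 first.
  - exact/measurable_EFinP.
  - rewrite oppE; apply: eq_integrable (integrable_half_pareto M bgN) => //.
    by move=> u /set_mem /kNE /= ->.
  by rewrite oppE; apply: eq_integral => u /set_mem /kNE /= ->.
by rewrite right_half left_half EFinD.
Qed.

End Pareto.

(** * The Kendall pair kernel on even functions and its one-sided cut-off *)

Section SymmetricPair.
Context {R : realType}.
Variable alpha : R.
Hypothesis alpha_gt0 : 0 < alpha.
Local Notation leb := (@lebesgue_measure R).

(* For even [phi], the integral of [phi] against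
   [delta~_x Kendall delta~_z]. *)
Definition sym_pair (phi : R -> R) (x z : R) : R :=
  let M := Num.max `|x| `|z| in
  let rho := Num.min `|x| `|z| / M in
  if M == 0 then phi 0
  else rho `^ alpha * (2 * half_pareto alpha phi M) + (1 - rho `^ alpha) * phi M.

Lemma sym_pair_linear (c d : R) {phi psi : R -> R} (x z : R) :
  bounded_measurable phi -> bounded_measurable psi ->
  sym_pair (fun y => c * phi y + d * psi y) x z =
  c * sym_pair phi x z + d * sym_pair psi x z.
Proof.
move=> bphi bpsi; rewrite /sym_pair; case: ifP => // _.
by rewrite half_pareto_linear//; ring.
Qed.

Lemma sym_pairC (phi : R -> R) (x z : R) : sym_pair phi x z = sym_pair phi z x.
Proof. by rewrite /sym_pair maxC minC. Qed.

(** The barrier [y <= a] leads to closed balls and the final event |y| < t to open ones. Both are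
    kept because the kernel has atoms, so values on the spheres count. *)
Definition closed_ball_ind (s y : R) : R := if `|y| <= s then 1 else 0.
Definition open_ball_ind (s y : R) : R := if `|y| < s then 1 else 0.

Lemma closed_ball_ind_bounded (s : R) : bounded_measurable (closed_ball_ind s).
Proof.
split; last first.
  by exists 1 => x; rewrite /closed_ball_ind; case: ifP; rewrite ?normr1 ?normr0.
apply: measurable_fun_ifT => //.
by apply: measurable_fun_ler => //; exact: normr_measurable.
Qed.

Lemma open_ball_ind_bounded (s : R) : bounded_measurable (open_ball_ind s).
Proof.
split; last first.
  by exists 1 => x; rewrite /open_ball_ind; case: ifP; rewrite ?normr1 ?normr0.
apply: measurable_fun_ifT => //.
by apply: measurable_fun_ltr => //; exact: normr_measurable.
Qed.

Lemma Psi_bounded (s : R) : bounded_measurable (fun y => Psi alpha (y / s)).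
Proof.
split.
  apply: measurable_maxr => //; apply: measurable_funB => //.
  apply: (measurableT_comp (measurable_powR _)).
  by apply: measurableT_comp; [exact: normr_measurable|exact: measurable_funM].
exists 1 => x; rewrite /Psi ger0_norm ?le_max ?lexx ?orbT//.
Qed.

(** The pair law is symmetric. On its positive half the barrier [y <= a] is the cut-off to the
    closed ball, on its negative half it is always met since [0 <= a]; the result is the average of
    the two cases. *)
Lemma kendall_pair_intE (a : R) (h : R -> R) (x z : R) : 0 <= a ->
  bounded_measurable h -> (forall y, h (- y) = h y) ->
  kendall_pair_int alpha
    (fun y => if (y <= a)%R then (h y)%:E else 0%E) x z =
  ((sym_pair h x z + sym_pair (fun y => closed_ball_ind a y * h y) x z) / 2)%:E.
Proof.
move=> a0 bh hN.
pose g (y : R) := (if y <= a then 1 else 0) * h y.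
have bg : bounded_measurable g.
  apply: bounded_measurableM => //; split.
    by apply: measurable_fun_ifT => //; exact: measurable_fun_ler.
  by exists 1 => y; case: ifP; rewrite ?normr1 ?normr0.
have -> : (fun y => if (y <= a)%R then (h y)%:E else 0%E) = EFin \o g.
  by apply/funext => y; rewrite /g /=; case: ifP => _; rewrite ?mul1r ?mul0r.
have gpos (y : R) : 0 <= y -> g y = closed_ball_ind a y * h y.
  by move=> y0; rewrite /g /closed_ball_ind ger0_norm.
have gneg (y : R) : 0 <= y -> g (- y) = h y.
  by move=> y0; rewrite /g hN (le_trans _ a0) ?oppr_le0// mul1r.
rewrite /kendall_pair_int /sym_pair.
set M := Num.max _ _; case: ifPn => [_|Mn0].
  by congr EFin; rewrite gpos// /closed_ball_ind normr0 a0; field.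
have M0 : 0 <= M by rewrite /M le_max normr_ge0.
rewrite (pareto_int_half _ alpha_gt0)//=.
rewrite -!EFinM -!EFinD gpos// gneg//.
have -> : half_pareto alpha g M =
    half_pareto alpha (fun y => closed_ball_ind a y * h y) M.
  apply: eq_Rintegral => u /set_mem/=; rewrite in_itv/= andbT => u1.
  by rewrite gpos// mulr_ge0// (le_trans ler01).
have -> : half_pareto alpha (fun y => g (- y)) M = half_pareto alpha h M.
  apply: eq_Rintegral => u /set_mem/=; rewrite in_itv/= andbT => u1.
  by rewrite gneg// mulr_ge0// (le_trans ler01).
by congr EFin; field.
Qed.

(** The integrand vanishes for [u > s / M], and the single point [u = s / M] is Lebesgue-null, so
    the value of [phi] on the sphere of radius [s] is irrelevant. *)
Lemma half_pareto_support (phi : R -> R) (s M : R) : bounded_measurable phi ->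
  (forall y, s < `|y| -> phi y = 0) -> 0 < M -> M <= s ->
  half_pareto alpha phi M =
  \int[leb]_(u in `[1, s / M[) (phi (M * u) * pareto_weight alpha u).
Proof.
move=> bphi phi0 M0 Ms.
have S1 : 1 <= s / M by rewrite ler_pdivlMr// mul1r.
have int_phi := integrable_half_pareto _ alpha_gt0 M bphi.
have := Rintegral_itvB int_phi (_ : (BLeft 1 <= BRight (s / M))%O) isT.
rewrite bnd_simp => /(_ S1) H.
have : \int[leb]_(u in `]s / M, +oo[) (phi (M * u) * pareto_weight alpha u) = 0.
  rewrite /Rintegral integral0_eq// => u /=; rewrite in_itv/= andbT ltr_pdivrMr// => su.
  rewrite phi0 ?mul0r// mulrC; by rewrite (lt_le_trans su) ?ler_norm.
rewrite -H => /eqP; rewrite subr_eq0 => /eqP.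
rewrite -Rintegral_itv_bndo_bndc//.
apply: integrableS int_phi => //.
by apply: subset_itvl; rewrite bnd_simp.
Qed.

Lemma half_pareto_outside (phi : R -> R) (s M : R) :
  (forall y, s < `|y| -> phi y = 0) -> 0 < M -> s < M ->
  half_pareto alpha phi M = 0.
Proof.
move=> phi0 M0 sM; rewrite /half_pareto /Rintegral integral0_eq// => u /=.
rewrite in_itv/= andbT => u1.
rewrite phi0 ?mul0r// ger0_norm ?mulr_ge0 ?(le_trans ler01 u1) ?ltW//.
by rewrite (lt_le_trans sM)// ler_peMr// ltW.
Qed.

End SymmetricPair.

(** * The pair kernel on ball indicators and on [Psi] *)

Section CutoffPair.
Context {R : realType}.
Variable alpha : R.
Hypothesis alpha_gt0 : 0 < alpha.
Local Notation leb := (@lebesgue_measure R).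

Lemma pareto_weightE (u : R) :
  pareto_weight alpha u = 2^-1 * ((2 * alpha) * u `^ (- (2 * alpha) - 1)).
Proof. by rewrite /pareto_weight; field. Qed.

(** Only [u < s / M] contributes, with doubled mass 1 - (M/s)^(2 alpha). Writing this with the
    square of (M/s)^alpha makes the later identities polynomial. *)
Lemma half_pareto_ind (e : R -> R) (s M : R) : bounded_measurable e ->
  (forall y, `|y| < s -> e y = 1) -> (forall y, s < `|y| -> e y = 0) ->
  0 < M -> M <= s ->
  2 * half_pareto alpha e M = 1 - ((M / s) `^ alpha) ^+ 2.
Proof.
move=> be e1 e0 M0 Ms.
have s0 : 0 < s := lt_le_trans M0 Ms.
have a2 : 0 < 2 * alpha by rewrite mulr_gt0.
have S1 : 1 <= s / M by rewrite ler_pdivlMr// mul1r.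
rewrite (half_pareto_support _ alpha_gt0 _ s)//.
under eq_Rintegral.
  move=> u; rewrite inE/= in_itv/= => /andP[u1 us].
  rewrite e1 ?mul1r ?pareto_weightE; last first.
    by rewrite ger0_norm ?mulr_ge0 ?(le_trans ler01 u1) ?ltW// mulrC -ltr_pdivlMr.
  over.
rewrite RintegralZl//; last exact: integrable_powR_itvco.
rewrite integral_powR_itv// mulrA divff// mul1r.
have P0 : 0 <= M / s by rewrite divr_ge0// ltW.
have -> : s / M = (M / s) `^ (- 1) by rewrite powR_inv1// invf_div.
by rewrite -powRrM mulN1r opprK (mulrC 2 alpha) powRrM powR_mulrn ?powR_ge0.
Qed.

Lemma Psi_inside (s y : R) : 0 < s -> `|y| <= s ->
  Psi alpha (y / s) = 1 - (`|y| / s) `^ alpha.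
Proof.
move=> s0 ys; rewrite /Psi normrM normfV (gtr0_norm s0).
apply/max_idPl; rewrite subr_ge0.
have := @ge0_ler_powR R alpha (ltW alpha_gt0) (`|y| / s) 1.
rewrite !nnegrE powR1; apply => //; first by rewrite divr_ge0// ltW.
by rewrite ler_pdivrMr// mul1r.
Qed.

Lemma Psi_outside (s y : R) : 0 < s -> s <= `|y| -> Psi alpha (y / s) = 0.
Proof.
move=> s0 sy; rewrite /Psi normrM normfV (gtr0_norm s0).
apply/max_idPr; rewrite subr_le0.
have := @ge0_ler_powR R alpha (ltW alpha_gt0) 1 (`|y| / s).
rewrite !nnegrE powR1; apply => //; first by rewrite divr_ge0// ltW.
by rewrite ler_pdivlMr// mul1r.
Qed.

(** Put P = (M/s)^alpha. On the support the integrand is the Pareto weight times 1 - P u^alpha, so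
    the two power integrals give (1 - P^2)/2 - P (1 - P) = (1 - P)^2 / 2. *)
Lemma half_pareto_Psi (s M : R) : 0 < M -> M <= s ->
  2 * half_pareto alpha (fun y => Psi alpha (y / s)) M =
  (1 - (M / s) `^ alpha) ^+ 2.
Proof.
move=> M0 Ms.
have s0 : 0 < s := lt_le_trans M0 Ms.
have a2 : 0 < 2 * alpha by rewrite mulr_gt0.
have S1 : 1 <= s / M by rewrite ler_pdivlMr// mul1r.
rewrite (half_pareto_support _ alpha_gt0 _ s)//; last 2 first.
- exact: Psi_bounded.
- by move=> y sy; rewrite Psi_outside// ltW.
pose P := (M / s) `^ alpha.
have P0 : 0 <= M / s by rewrite divr_ge0// ltW.
have -> : \int[leb]_(u in `[1, s / M[)
      (Psi alpha (M * u / s) * pareto_weight alpha u) =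
    \int[leb]_(u in `[1, s / M[)
      (2^-1 * ((2 * alpha) * u `^ (- (2 * alpha) - 1)) -
       P * (alpha * u `^ (- alpha - 1))).
  apply: eq_Rintegral => u; rewrite inE/= in_itv/= => /andP[u1 us].
  have u0 : 0 < u by rewrite (lt_le_trans ltr01).
  rewrite Psi_inside//; last first.
    by rewrite ger0_norm ?mulr_ge0 ?ltW// mulrC -ltr_pdivlMr.
  rewrite ger0_norm ?mulr_ge0 ?ltW// [M * u / s]mulrAC powRM ?(ltW u0)//.
  rewrite pareto_weightE.
  have -> : - alpha - 1 = alpha + (- (2 * alpha) - 1) by ring.
  rewrite [u `^ (alpha + _)]powRD; last by rewrite (gt_eqF u0) implybT.
  by rewrite -/P; field.
have i1 : leb.-integrable `[1, (s / M)[
    (EFin \o (fun u : R => 2^-1 * ((2 * alpha) * u `^ (- (2 * alpha) - 1)))).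
  exact: (integrableZl _ _ (integrable_powR_itvco (2 * alpha) (s / M) a2)).
have i2 : leb.-integrable `[1, (s / M)[
    (EFin \o (fun u : R => P * (alpha * u `^ (- alpha - 1)))).
  exact: (integrableZl _ _ (integrable_powR_itvco alpha (s / M) alpha_gt0)).
rewrite RintegralB// (@RintegralZl _ _ _ leb _ _ 2^-1)//; last first.
  exact: integrable_powR_itvco.
rewrite (@RintegralZl _ _ _ leb _ _ P)//; last exact: integrable_powR_itvco.
rewrite !integral_powR_itv//.
have -> : s / M = (M / s) `^ (- 1) by rewrite powR_inv1// invf_div.
rewrite -!powRrM !mulN1r !opprK (mulrC 2 alpha) powRrM powR_mulrn ?powR_ge0//.
by rewrite -/P; field.
Qed.

Lemma sym_pair_le (phi : R -> R) (x z : R) : `|x| <= `|z| -> 0 < `|z| ->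
  sym_pair alpha phi x z = (`|x| / `|z|) `^ alpha * (2 * half_pareto alpha phi `|z|) +
    (1 - (`|x| / `|z|) `^ alpha) * phi `|z|.
Proof.
move=> xz z0; rewrite /sym_pair.
by rewrite (max_idPr xz) (min_idPl xz) gt_eqF.
Qed.

(** The scale |z| cancels; this is how the mixing weight of the pair law disappears from the product
    formulas. *)
Lemma ratio_powRM (x z s : R) : `|z| > 0 -> 0 < s ->
  (`|x| / `|z|) `^ alpha * (`|z| / s) `^ alpha = (`|x| / s) `^ alpha.
Proof.
move=> z0 s0; rewrite -powRM ?divr_ge0 ?(ltW s0)//.
by rewrite mulrA divfK// gt_eqF.
Qed.

(* The value of [e] on the sphere [|y| = s] is left free. *)
Lemma sym_pair_ind (e : R -> R) (s x z : R) : 0 < s -> bounded_measurable e ->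
  (forall y, e (- y) = e y) ->
  (forall y, `|y| < s -> e y = 1) -> (forall y, s < `|y| -> e y = 0) ->
  sym_pair alpha e x z = Psi alpha (x / s) * e z +
    (e x - Psi alpha (x / s)) * Psi alpha (z / s).
Proof.
move=> s0 be eN e1 e0; pose psi y := Psi alpha (y / s).
(* Expanded, the right-hand side is psi(x) e(z) + e(x) psi(z) - psi(x) psi(z), symmetric in [x] and
   [z] like the left-hand side. *)
wlog xz : x z / `|x| <= `|z|.
  move=> H; have [/H//|/ltW zx] := lerP `|x| `|z|.
  by rewrite sym_pairC (H _ _ zx); ring.
have eabs y : e `|y| = e y by case: (ler0P y).
have [z0|z0] := eqVneq z 0.
  move: xz; rewrite z0 normr0 normr_le0 => /eqP ->.
  rewrite /sym_pair !normr0 maxxx eqxx !e1 ?normr0// mul0r.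
  by rewrite /Psi normr0 powR0 ?gt_eqF// subr0 max_l//; ring.
have nz0 : 0 < `|z| by rewrite normr_gt0.
rewrite sym_pair_le// eabs.
have [sz|zs] := ltrP s `|z|.
  by rewrite (half_pareto_outside _ _ s)// (Psi_outside _ z) ?(ltW sz)// e0//; ring.
rewrite (half_pareto_ind _ s)// !Psi_inside// ?(le_trans xz)//.
rewrite -[in RHS](ratio_powRM x z)//.
(* On the sphere |z| = s the Pareto part and [Psi (z / s)] both vanish, so the free value [e z] has
   the same factor on both sides. *)
move: zs; rewrite le_eqVlt => /predU1P[zs|zs].
  rewrite zs divff ?gt_eqF// powR1.
  by ring.
by rewrite !e1 ?(le_lt_trans xz)//; ring.
Qed.

(** [Psi] is multiplicative for the Kendall convolution. For |x| <= |z| <= s, with r =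
    (|x|/|z|)^alpha and P = (|z|/s)^alpha, the kernel gives r (1 - P)^2 + (1 - r)(1 - P) = (1 - P)(1
    - r P). *)
Lemma sym_pair_Psi (s x z : R) : 0 < s ->
  sym_pair alpha (fun y => Psi alpha (y / s)) x z =
  Psi alpha (x / s) * Psi alpha (z / s).
Proof.
move=> s0.
wlog xz : x z / `|x| <= `|z|.
  move=> H; have [/H//|/ltW zx] := lerP `|x| `|z|.
  by rewrite sym_pairC (H _ _ zx); ring.
have [z0|z0] := eqVneq z 0.
  move: xz; rewrite z0 normr0 normr_le0 => /eqP ->.
  rewrite /sym_pair !normr0 maxxx eqxx mul0r.
  by rewrite /Psi normr0 powR0 ?gt_eqF// subr0 max_l//; ring.
have nz0 : 0 < `|z| by rewrite normr_gt0.
rewrite sym_pair_le//.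
have [sz|zs] := ltrP s `|z|.
  rewrite (half_pareto_outside _ _ s)//; last first.
    by move=> y sy; rewrite Psi_outside// ltW.
  by rewrite (Psi_outside _ z) ?(Psi_outside _ `|z|) ?normr_id ?(ltW sz)//; ring.
rewrite (half_pareto_Psi s)// !Psi_inside ?normr_id ?(le_trans xz)//.
by rewrite -[in RHS](ratio_powRM x z)//; ring.
Qed.

End CutoffPair.

(** * Integrals against a symmetric law and its distribution function *)

Section SymmetricLaw.
Context {R : realType}.
Variable nu : probability R R.
Hypothesis nu_sym : symmetric_prob nu.

Lemma Rintegral_sym (g : R -> R) : bounded_measurable g ->
  \int[nu]_x g (- x) = \int[nu]_x g x.
Proof.
move=> bg; congr fine.
transitivity (\int[pushforward nu (-%R : R -> R)]_x (g x)%:E)%E; last first.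
  by apply: eq_measure_integral => A mA _; exact: nu_sym.
have mopp : measurable_fun setT (-%R : R -> R) by exact: oppr_measurable.
rewrite (integral_pushforward mopp)//.
- by apply/measurable_EFinP; case: bg.
- rewrite preimage_setT.
  apply: (bounded_measurable_integrable nu (f := fun x => g (- x))).
  by apply: (bounded_measurable_comp bg); exact: oppr_measurable.
Qed.

(** The ray below [- s] is the mirror image of the complement of []-oo, s]], so it has mass 1 -
    F(s), which is removed from F(s). *)
Lemma prob_closed_ball (s : R) : 0 < s ->
  fine (nu [set` `[- s, s]]) = 2 * cdfF nu s - 1.
Proof.
move=> s0.
have fin (A : set R) : measurable A -> nu A \is a fin_num.
  by move=> mA; exact: fin_num_measure.
have tail : nu [set` `]-oo, (- s)[] = (1 - nu [set` `]-oo, s]])%E.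
  rewrite -nu_sym// -probability_setC//; congr (nu _).
  by apply/seteqP; split => y /=; rewrite !in_itv/= ltrN2 real_ltNge ?num_real// => /negP.
have split_cdf : nu [set` `]-oo, s]] =
    (nu [set` `]-oo, (- s)%R[] + nu [set` `[(- s)%R, s]])%E.
  rewrite -measureU//; last first.
    apply/seteqP; split => y //= []; rewrite !in_itv/= => ys /andP[sy _].
    by have := lt_le_trans ys sy; rewrite ltxx.
  congr (nu _); apply/seteqP; split => y /=; rewrite !in_itv/=.
    by move=> ys; rewrite ys andbT; have [] := ltrP y (- s); [left|right].
  by move=> [ys|/andP[]//]; rewrite ltW// (lt_trans ys)// gtrN.
move: split_cdf; rewrite tail /cdfF.
rewrite -(fineK (fin [set` `]-oo, s]] _))// -(fineK (fin [set` `[- s, s]] _))//.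
rewrite -EFinB -EFinD => -[] /= H.
by lra.
Qed.

(** By symmetry [- s] is null as well, so [e] agrees almost everywhere with the indicator of the
    closed ball. *)
Lemma Rintegral_cutoff (e : R -> R) (s : R) : 0 < s -> nu [set s] = 0%E ->
  bounded_measurable e ->
  (forall y, `|y| < s -> e y = 1) -> (forall y, s < `|y| -> e y = 0) ->
  \int[nu]_x e x = 2 * cdfF nu s - 1.
Proof.
move=> s0 nus be e1 e0; rewrite -prob_closed_ball//; congr fine.
have nuNs : nu [set - s] = 0%E.
  rewrite -nus -nu_sym//; congr (nu _); apply/seteqP; split => y /=.
    by move=> /oppr_inj.
  by move=> ->.
transitivity (\int[nu]_x (\1_[set` `[(- s)%R, s]] x : R)%:E)%E; last first.
  by rewrite integral_indic// setIT.
apply: ae_eq_integral => //.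
- by apply/measurable_EFinP; case: be.
- exact/measurable_EFinP.
exists ([set s] `|` [set - s]); split.
- exact: measurableU.
- by rewrite measureU0.
move=> y /= H; apply: contrapT => yn; apply: H => _; congr EFin.
have ys : `|y| != s.
  apply/eqP; case: ler0P => _ ys; apply: yn; [right|left] => //=.
  by rewrite -ys opprK.
rewrite indicE; case: (ltrgtP `|y| s) ys => // ys _.
  by rewrite e1// mem_set//= in_itv/= -ler_norml ltW.
rewrite e0// memNset//= in_itv/= -ler_norml => /(lt_le_trans ys).
by rewrite ltxx.
Qed.

End SymmetricLaw.

(** * One step of the walk on the span of the four cut-off functions *)

Section Walk.
Context {R : realType}.
Variables (alpha : R) (nu : probability R R) (a t : R).
Hypotheses (alpha_gt0 : 0 < alpha) (nu_sym : symmetric_prob nu).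
Hypotheses (a_gt0 : 0 < a) (a_le_t : a <= t).
Hypotheses (nua : nu [set a] = 0%E) (nut : nu [set t] = 0%E).

Let t_gt0 : 0 < t := lt_le_trans a_gt0 a_le_t.
Local Notation Ga := (Gf alpha nu a).
Local Notation Gt := (Gf alpha nu t).
Local Notation Ha := (Hf alpha nu a).
Local Notation Ht := (Hf alpha nu t).
Local Notation psi := (Psi alpha (a / t)).

(* The factor [open_ball_ind t] only matters at [|y| = a] when [a = t]. *)
Definition inner_ind (y : R) : R := closed_ball_ind a y * open_ball_ind t y.

(** Only the four coefficients are followed. For [a = t] the four functions coincide in pairs; the
    coefficients are then not unique, but the rules below still hold. *)
Definition comb (al be ga de y : R) : R :=
  al * open_ball_ind t y + be * Psi alpha (y / t) +
  ga * inner_ind y + de * Psi alpha (y / a).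

Lemma ball_indN (s y : R) :
  (closed_ball_ind s (- y) = closed_ball_ind s y) *
  (open_ball_ind s (- y) = open_ball_ind s y).
Proof. by rewrite /closed_ball_ind /open_ball_ind normrN. Qed.

Lemma PsiN (y : R) : Psi alpha (- y) = Psi alpha y.
Proof. by rewrite /Psi normrN. Qed.

Lemma inner_ind_bounded : bounded_measurable inner_ind.
Proof.
apply: bounded_measurableM.
- exact: closed_ball_ind_bounded.
- exact: open_ball_ind_bounded.
Qed.

Lemma inner_ind_inside (y : R) : `|y| < a -> inner_ind y = 1.
Proof.
move=> ya; rewrite /inner_ind /closed_ball_ind /open_ball_ind.
by rewrite ltW// (lt_le_trans ya a_le_t) mulr1.
Qed.

Lemma inner_ind_outside (y : R) : a < `|y| -> inner_ind y = 0.
Proof.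
by move=> ya; rewrite /inner_ind /closed_ball_ind leNgt ya mul0r.
Qed.

Lemma open_ball_ind_inside (y : R) : `|y| < t -> open_ball_ind t y = 1.
Proof. by rewrite /open_ball_ind => ->. Qed.

Lemma open_ball_ind_outside (y : R) : t < `|y| -> open_ball_ind t y = 0.
Proof. by move=> ty; rewrite /open_ball_ind ltNge ltW. Qed.

Lemma combN (al be ga de y : R) : comb al be ga de (- y) = comb al be ga de y.
Proof. by rewrite /comb /inner_ind !ball_indN !mulNr !PsiN. Qed.

Lemma comb_bounded (al be ga de : R) : bounded_measurable (comb al be ga de).
Proof.
do 3?[apply: bounded_measurableD]; apply: bounded_measurableZ.
- exact: open_ball_ind_bounded.
- exact: Psi_bounded.
- exact: inner_ind_bounded.
- exact: Psi_bounded.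
Qed.

Lemma Rintegral_Psi (s : R) : \int[nu]_x Psi alpha (x / s) = Gf alpha nu s.
Proof. by []. Qed.

Lemma Rintegral_linear (c d : R) (f g : R -> R) :
  bounded_measurable f -> bounded_measurable g ->
  \int[nu]_x (c * f x + d * g x) = c * \int[nu]_x f x + d * \int[nu]_x g x.
Proof.
move=> bf bg; rewrite RintegralD ?RintegralZl//;
  by apply: bounded_measurable_integrable => //; exact: bounded_measurableZ.
Qed.

(** A ball indicator integrates to 2F - 1, which is G + H by the definition of [Hf]. *)
Lemma Rintegral_comb (al be ga de : R) :
  \int[nu]_x comb al be ga de x =
  al * (Gt + Ht) + be * Gt + ga * (Ga + Ha) + de * Ga.
Proof.
have bo := open_ball_ind_bounded t.
have bin := inner_ind_bounded.
have bP (s : R) := Psi_bounded alpha s.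
transitivity (\int[nu]_x
   (1 * (al * open_ball_ind t x + be * Psi alpha (x / t)) +
    1 * (ga * inner_ind x + de * Psi alpha (x / a)))).
  by apply: eq_Rintegral => x _; rewrite /comb !mul1r addrA.
rewrite !Rintegral_linear//;
  try by apply: bounded_measurableD; exact: bounded_measurableZ.
rewrite !Rintegral_Psi.
rewrite (Rintegral_cutoff _ nu_sym _ t)//; last 2 first.
- exact: open_ball_ind_inside.
- exact: open_ball_ind_outside.
rewrite (Rintegral_cutoff _ nu_sym _ a)//; last 2 first.
- exact: inner_ind_inside.
- exact: inner_ind_outside.
rewrite /Hf; move: (cdfF nu t) (cdfF nu a) Gt Ga => ? ? ? ?.
by ring.
Qed.

(** For |y| <= a, (|y|/t)^alpha is the product of (a/t)^alpha and (|y|/a)^alpha, so [Psi (y / t)] is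
    affine in [Psi (y / a)]. *)
Lemma closed_ball_ind_comb (al be ga de y : R) :
  closed_ball_ind a y * comb al be ga de y =
  comb 0 0 (al + be * psi + ga) (be * (1 - psi) + de) y.
Proof.
rewrite /comb /inner_ind /closed_ball_ind.
have [ya|ya] := ltrP a `|y|.
  rewrite /= (Psi_outside _ alpha_gt0 a)// ?ltW//.
  by ring.
rewrite mul1r.
have yt := le_trans ya a_le_t.
have r := ratio_powRM alpha y a t.
rewrite (gtr0_norm a_gt0) in r; move: r => /(_ a_gt0 t_gt0) r.
have psiE : psi = 1 - (a / t) `^ alpha.
  by rewrite Psi_inside// (gtr0_norm a_gt0).
rewrite !Psi_inside// ?(gtr0_norm a_gt0)// -r /open_ball_ind.
(* If |y| = t, then |y| <= a <= t forces [a = t], and both sides vanish. *)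
move: yt; rewrite le_eqVlt => /predU1P[yt|->]; last by ring.
have ta : t = a by apply/eqP; rewrite eq_le a_le_t andbT -yt.
by rewrite yt ltxx ta divff ?gt_eqF// powR1; ring.
Qed.

(** For fixed [x] the result is again a combination in [z], so [Rintegral_comb] can integrate it
    over [z]. *)
Lemma sym_pair_comb (al be ga de x z : R) :
  sym_pair alpha (comb al be ga de) x z =
  comb (al * Psi alpha (x / t))
       (al * (open_ball_ind t x - Psi alpha (x / t)) + be * Psi alpha (x / t))
       (ga * Psi alpha (x / a))
       (ga * (inner_ind x - Psi alpha (x / a)) + de * Psi alpha (x / a)) z.
Proof.
have bo := open_ball_ind_bounded t.
have bin := inner_ind_bounded.
have bP (s : R) := Psi_bounded alpha s.
transitivity (sym_pair alpha (fun y =>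
   1 * (al * open_ball_ind t y + be * Psi alpha (y / t)) +
    1 * (ga * inner_ind y + de * Psi alpha (y / a))) x z).
  by congr (sym_pair alpha _ x z); apply/funext => y; rewrite /comb !mul1r addrA.
rewrite !sym_pair_linear//; try by apply: bounded_measurableD; exact: bounded_measurableZ.
rewrite !sym_pair_Psi// (sym_pair_ind _ alpha_gt0 _ t)//; last 3 first.
- by move=> y; rewrite ball_indN.
- exact: open_ball_ind_inside.
- exact: open_ball_ind_outside.
rewrite (sym_pair_ind _ alpha_gt0 _ a)//; last 3 first.
- by move=> y; rewrite /inner_ind !ball_indN.
- exact: inner_ind_inside.
- exact: inner_ind_outside.
rewrite /comb.
move: (Psi alpha (x / t)) (Psi alpha (z / t)) (Psi alpha (x / a)) (Psi alpha (z / a)).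
by move=> *; ring.
Qed.

Lemma EFin_Rintegral (f : R -> R) : bounded_measurable f ->
  (\int[nu]_x (f x)%:E)%E = (\int[nu]_x f x)%:E.
Proof.
move=> bf; rewrite fineK//.
by apply: (integrable_fin_num _ (bounded_measurable_integrable nu bf)).
Qed.

(** The step averages an uncut and a cut combination. The coefficients at [t] survive only in the
    uncut half, hence [Gt / 2]; those at [a] survive in both halves, hence [Ga]. *)
Lemma kernel_int_comb (al be ga de x : R) :
  kernel_int alpha nu
    (fun y => if (y <= a)%R then (comb al be ga de y)%:E else 0%E) x =
  (comb (Gt / 2 * al) (Gt / 2 * be + Ht / 2 * al)
     (Ga * (ga + (al + psi * be) / 2))
     (Ga * (de + be * (1 - psi) / 2) + Ha * (ga + (al + psi * be) / 2)) x)%:E.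
Proof.
pose h := comb al be ga de.
pose k := comb 0 0 (al + be * psi + ga) (be * (1 - psi) + de).
have kE : (fun y => closed_ball_ind a y * h y) = k.
  by apply/funext => y; rewrite /h closed_ball_ind_comb.
transitivity (\int[nu]_z
    (2^-1 * sym_pair alpha h x z + 2^-1 * sym_pair alpha k x z)%:E)%E.
  apply: eq_integral => z _.
  rewrite (kendall_pair_intE _ alpha_gt0 _ _ _ _ (ltW a_gt0)); last 2 first.
  - exact: comb_bounded.
  - exact: combN.
  by rewrite kE -mulrDr mulrC.
rewrite /h /k; under eq_integral do rewrite !sym_pair_comb.
rewrite EFin_Rintegral; last first.
  by apply: bounded_measurableD; apply: bounded_measurableZ; exact: comb_bounded.
rewrite Rintegral_linear; [|exact: comb_bounded..].
rewrite !Rintegral_comb; congr EFin; rewrite /comb.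
move: (open_ball_ind t x) (Psi alpha (x / t)) (inner_ind x) (Psi alpha (x / a)).
move: psi Ha Ht Ga Gt => p ha ht ga' gt e1 p1 e2 p2.
by field.
Qed.

(** The first step has law [nu], the kernel at 0. All four functions equal 1 at 0, so the value is
    the sum of the coefficients in [kernel_int_comb]. *)
Lemma Rintegral_le_comb (al be ga de : R) :
  fine (\int[nu]_x (if (x <= a)%R then (comb al be ga de x)%:E else 0%E)) =
  Gt / 2 * al + (Gt / 2 * be + Ht / 2 * al) +
  Ga * (ga + (al + psi * be) / 2) +
  (Ga * (de + be * (1 - psi) / 2) + Ha * (ga + (al + psi * be) / 2)).
Proof.
pose h := comb al be ga de.
pose k := comb 0 0 (al + be * psi + ga) (be * (1 - psi) + de).
pose g (y : R) := (if y <= a then 1 else 0) * h y.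
have bg : bounded_measurable g.
  apply: bounded_measurableM; last exact: comb_bounded.
  split; first by apply: measurable_fun_ifT => //; exact: measurable_fun_ler.
  by exists 1 => y; case: ifP; rewrite ?normr1 ?normr0.
have bgN : bounded_measurable (fun y => g (- y)).
  by apply: (bounded_measurable_comp bg); exact: oppr_measurable.
transitivity (\int[nu]_x g x).
  congr fine; apply: eq_integral => x _; rewrite /g.
  by case: ifP => _; rewrite ?mul1r ?mul0r.
(* Symmetrising under [nu] turns the one-sided barrier into the average of [h] and its restriction
   to the closed ball. *)
transitivity (\int[nu]_x (2^-1 * g x + 2^-1 * g (- x))).
  rewrite Rintegral_linear// Rintegral_sym//.
  by move: (Rintegral _ _ _) => r; field.
transitivity (\int[nu]_x (2^-1 * h x + 2^-1 * k x)).
  apply: eq_Rintegral => x _; rewrite -!mulrDr; congr (_ * _).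
  rewrite /k -closed_ball_ind_comb -/h /g /h combN /closed_ball_ind.
  have [x0|x0] := ler0P x.
    by rewrite (le_trans x0 (ltW a_gt0)) mul1r; case: ifP => _; rewrite ?mul1r ?mul0r.
  have -> : - x <= a by rewrite (le_trans _ (ltW a_gt0))// oppr_le0 ltW.
  by rewrite mul1r addrC; case: ifP => _; rewrite ?mul1r ?mul0r.
rewrite Rintegral_linear; [|exact: comb_bounded..].
rewrite !Rintegral_comb; move: psi Ha Ht Ga Gt => p ha ht ga' gt.
by field.
Qed.

(** * Explicit solution of the coefficient recurrence *)

Hypothesis GtGa : Gt != 2 * Ga.

Lemma Gf_ge0 (s : R) : 0 <= Gf alpha nu s.
Proof. by apply: Rintegral_ge0 => x _; rewrite /Psi le_max lexx orbT. Qed.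

(** [Psi (x / s)] grows with [s], so 0 <= Ga <= Gt; if [Gt] were 0, so would be [Ga], contradicting
    [GtGa]. *)
Lemma Gt_neq0 : Gt != 0.
Proof.
apply: contra GtGa => /eqP Gt0; rewrite Gt0.
have : Ga <= Gt.
  apply: le_Rintegral => //;
    try by apply: bounded_measurable_integrable; exact: Psi_bounded.
  move=> x _; rewrite /Psi ge_max !le_max lexx orbT andbT.
  apply/orP; left; rewrite lerD2l lerN2.
  apply: ge0_ler_powR; rewrite ?nnegrE ?(ltW alpha_gt0)//.
  by rewrite !normrM ler_wpM2l// !normfV !gtr0_norm// lef_pV2.
rewrite Gt0 => Ga_le0.
have -> : Ga = 0 by apply/eqP; rewrite eq_le Ga_le0 Gf_ge0.
by rewrite mulr0.
Qed.

Let D := 2 * Ga - Gt.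

Let D_neq0 : D != 0.
Proof. by rewrite subr_eq0 eq_sym. Qed.

(* The coefficients of the iterates solve a triangular linear recurrence with
   the double eigenvalues [Gt / 2] and [Ga]. *)
Let L := Ht / Gt.
Let C := - psi * Ga * L / D.
Let B := (C * Gt - Ga) / D.
Let F := Ha * (1 + psi * Ht / D) / D.
Let C' := - (2 * Ha * C + (psi * Ha + (1 - psi) * Ga) * L) / D.
Let B' := (C' * Gt - 2 * Ha * B - Ha) / D.

Definition coef_open (n : nat) : R := (Gt / 2) ^+ n.
Definition coef_Psi_t (n : nat) : R := n%:R * L * (Gt / 2) ^+ n.
(** [C] and [B] come from matching the terms in n (Gt/2)^n and (Gt/2)^n of a particular solution;
    the term in [Ga ^+ n] makes the value 0 at n = 0. *)
Definition coef_inner (n : nat) : R :=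
  - B * Ga ^+ n + (B + C * n%:R) * (Gt / 2) ^+ n.
(** The source [Ha * coef_inner] contains [Ga ^+ n], which is resonant and produces the term in [F].
    Matching requires F Ga = - Ha B; [F] is written with [Ga] already cancelled. *)
Definition coef_Psi_a (n : nat) : R :=
  (- B' + F * n%:R) * Ga ^+ n + (B' + C' * n%:R) * (Gt / 2) ^+ n.

Lemma coef_openS (n : nat) : coef_open n.+1 = Gt / 2 * coef_open n.
Proof. by rewrite /coef_open exprS. Qed.

Lemma coef_Psi_tS (n : nat) :
  coef_Psi_t n.+1 = Gt / 2 * coef_Psi_t n + Ht / 2 * coef_open n.
Proof.
rewrite /coef_Psi_t /coef_open exprS -natr1 /L.
move: Gt_neq0; move: ((Gt / 2) ^+ n) (n%:R : R) => x m.
by move: Gt Ht => gt ht gt0; field.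
Qed.

Lemma coef_innerS (n : nat) :
  coef_inner n.+1 =
  Ga * (coef_inner n + (coef_open n + psi * coef_Psi_t n) / 2).
Proof.
rewrite /coef_inner /coef_Psi_t /coef_open !exprS -natr1 /B /C /L.
move: Gt_neq0 D_neq0; rewrite /D.
move: ((Gt / 2) ^+ n) (Ga ^+ n) (n%:R : R) => x y m.
by move: psi Ha Ht Ga Gt => p ha ht ga gt gt0 d0; field; rewrite ?d0 ?gt0.
Qed.

Lemma coef_Psi_aS (n : nat) :
  coef_Psi_a n.+1 =
  Ga * (coef_Psi_a n + coef_Psi_t n * (1 - psi) / 2) +
  Ha * (coef_inner n + (coef_open n + psi * coef_Psi_t n) / 2).
Proof.
rewrite /coef_Psi_a /coef_inner /coef_Psi_t /coef_open !exprS -natr1.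
rewrite /F /B' /C' /B /C /L.
move: Gt_neq0 D_neq0; rewrite /D.
move: ((Gt / 2) ^+ n) (Ga ^+ n) (n%:R : R) => x y m.
by move: psi Ha Ht Ga Gt => p ha ht ga gt gt0 d0; field; rewrite ?d0 ?gt0.
Qed.

(** The start [hseq 0] is the open ball indicator, with coefficients 1, 0, 0, 0; each further
    integration is [kernel_int_comb]. *)
Lemma hseq_comb (n : nat) (x : R) :
  hseq alpha nu a t n x =
  (comb (coef_open n) (coef_Psi_t n) (coef_inner n) (coef_Psi_a n) x)%:E.
Proof.
elim: n x => [|n IHn] x.
  rewrite /comb /coef_open /coef_Psi_t /coef_inner /coef_Psi_a /= !expr0 !mulr0.
  congr EFin; rewrite /open_ball_ind.
  move: (Psi alpha (x / t)) (inner_ind x) (Psi alpha (x / a)) => p i q.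
  by move: B B' (if `|x| < t then 1 else 0 : R) => b b' e; ring.
rewrite coef_openS coef_Psi_tS coef_innerS coef_Psi_aS -kernel_int_comb /=.
by congr kernel_int; apply/funext => y; rewrite IHn.
Qed.

(** The outermost integral is against [nu] itself, so [Rintegral_le_comb] applies and yields the sum
    of the next coefficients. *)
Lemma II_coef (n : nat) :
  II alpha nu n.+1 a t =
  coef_open n.+1 + coef_Psi_t n.+1 + coef_inner n.+1 + coef_Psi_a n.+1.
Proof.
rewrite coef_openS coef_Psi_tS coef_innerS coef_Psi_aS -Rintegral_le_comb.
congr fine; apply: eq_integral => x _ /=.
by rewrite hseq_comb.
Qed.

End Walk.

(** * Comparison of the solved recurrence with the stated constants *)

Theorem mainTheorem8 (R : realType) (alpha : R) (nu : probability R R) (a t : R) :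
  0 < alpha -> symmetric_prob nu -> nu [set 0] = 0%E ->
  0 < a -> a <= t -> nu [set a] = 0%E -> nu [set t] = 0%E ->
  Gf alpha nu t != 2 * Gf alpha nu a ->
  let Ga := Gf alpha nu a in
  let Gt := Gf alpha nu t in
  let Ha := Hf alpha nu a in
  let Ht := Hf alpha nu t in
  let D := 2 * Ga - Gt in
  let psi := Psi alpha (a / t) in
  let I1 := Gt / 2 + Ha * psi / 2 + Ga / 2 in
  let C1 := I1 - Ga / D * (Ga + Ha * psi * (1 - Gt / D)) in
  let C2 := Ha * psi / D in
  let C3 := (Ha * psi + Ga) / D - 2 * Ha * Ga * psi / D ^+ 2 in
  let II1 := II alpha nu 1 a t in
  II1 = (Ha + Ht + Ga + Gt) / 2 /\
  forall n : nat, (2 <= n)%N ->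
    II alpha nu n a t =
      Ga ^+ n * ((n.+1%:R * Ha + Ga) / D - 2 * Ga * Ha / D ^+ 2
                 + Ht / D * (n%:R * C2 + C3 - 2 * C2 * Ga / D))
    + (Gt / 2) ^+ (n - 1) *
        (II1 - Ga * (Ha + Ga) / D + Ga * Gt * Ha / D ^+ 2
         + (n - 1)%:R * C1 * Ht / Gt - Ga * Ht / D * (C3 - C2 * Gt / D)).
Proof.
move=> alpha0 nu_sym _ a0 at_ nua nut GtGa Ga Gt Ha Ht D psi I1 C1 C2 C3 II1.
have Gt0 : Gt != 0 by exact: (Gt_neq0 alpha nu a t alpha0 a0 at_ GtGa).
have D0 : 2 * Ga - Gt != 0 by rewrite subr_eq0 eq_sym.
have II1E : II1 = (Ha + Ht + Ga + Gt) / 2.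
  rewrite /II1 II_coef// /coef_Psi_a /coef_inner /coef_Psi_t /coef_open !expr1.
  rewrite -/Ga -/Gt -/Ha -/Ht -/psi; clearbody Ga Gt Ha Ht psi.
  by field; rewrite ?D0 ?Gt0.
split=> // -[//|[//|n]] _; rewrite II1E II_coef// subn1 [n.+2.-1]/=.
rewrite /coef_Psi_a /coef_inner /coef_Psi_t /coef_open.
rewrite /C1 /I1 /C2 /C3 /D -/Ga -/Gt -/Ha -/Ht -/psi !exprS -!natr1.
(* With both powers and [n] replaced by free variables, the claim is a rational identity whose only
   denominators, besides numerals, are [D] and [Gt]. *)
move: ((Gt / 2) ^+ n) (Ga ^+ n) (n%:R : R) => x y m.
clearbody Ga Gt Ha Ht psi.
by field; rewrite ?D0 ?Gt0.
Qed.
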